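(* Let $n,k,i$ be integers with $i\ge 1$, $k\ge 1$ and $n\ge 2k$. The generating function for the major index of standard Young tableaux of shape $(n-k,k)$ with exactly $i$ descents, $$f_{(n-k,k),i}(q)=\sum_{\substack{T\in SYT((n-k,k))\\ |\mathrm{Des}(T)|=i}} q^{\mathrm{maj}(T)},$$ satisfies, as an identity of rational functions in $q$, $$f_{(n-k,k),i}(q) = \frac{q^{k+i^2-i}(1-q^{n-2k+1})}{1-q^i} \left[ {k-1 \atop i-1} \right]_q \left[ {n-k \atop i-1} \right]_q.$$
   Context: For a partition $\lambda$ of $n$, $SYT(\lambda)$ denotes the set of standard Young tableaux of shape $\lambda$: fillings of the Ferrers diagram of $\lambda$ (row 1 on top, with $\lambda_1$ boxes, row 2 below it with $\lambda_2$ boxes, and so on, left-justified) with the numbers $1,\dots,n$, each used once, such that entries increase along rows to the right and down columns. The descent set $\mathrm{Des}(T)$ of a tableau $T$ is the set of $j\in\{1,\dots,n-1\}$ such that $j$ lies in a strictly higher row than $j+1$ (i.e. $j+1$ lies in a row strictly below that of $j$). The number of descents is $|\mathrm{Des}(T)|$, and $\mathrm{maj}(T)=\sum_{j\in \mathrm{Des}(T)} j$. With $(q)_N=(1-q)(1-q^2)\cdots(1-q^N)$ and $(q)_0=1$, the $q$-binomial coefficient is $\left[ {A \atop B} \right]_q=\frac{(q)_A}{(q)_B(q)_{A-B}}$ for integers $0\le B\le A$, and $\left[ {A \atop B} \right]_q=0$ for $0\le A<B$. *)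

(* Defs.v *)
(* Mathematical Components *)
From mathcomp Require Import all_boot all_order all_algebra.
Set Implicit Arguments.
Unset Strict Implicit.
Unset Printing Implicit Defensive.
Import GRing.Theory.

Section Tableaux.

(* A partition is given by its parts, in weakly decreasing order. *)
Variable la : seq nat.

(* Rows and columns are numbered from 0, row 0 being the top row. *)
Definition box : finType := {r : 'I_(size la) & 'I_(nth 0 la r)}.

Definition box_row (b : box) : nat := tag b.
Definition box_col (b : box) : nat := tagged b.

(* With n = sumn la, entries lie in {0, ..., n}; a standard tableau uses
   exactly 1, ..., n, so the value 0 does not occur in it. *)
Definition filling : finType := {ffun box -> 'I_(sumn la).+1}.

Definition is_SYT (T : filling) : bool :=
  [&& perm_eq [seq val (T b) | b : box] (iota 1 (sumn la)),
      [forall b, forall c,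
         (box_row b == box_row c) && (box_col b < box_col c) ==> (T b < T c)]
    & [forall b, forall c,
         (box_col b == box_col c) && (box_row b < box_row c) ==> (T b < T c)]].

Definition SYT : {set filling} := [set T | is_SYT T].

Definition Des (T : filling) : {set 'I_(sumn la)} :=
  [set j : 'I_(sumn la) | (0 < j) &&
     [exists b, exists c,
        [&& T b == j :> nat, T c == j.+1 :> nat & box_row b < box_row c]]].

Definition maj (T : filling) : nat := \sum_(j in Des T) j.

End Tableaux.

Local Open Scope ring_scope.

Definition maj_genfun (la : seq nat) (i : nat) : {poly rat} :=
  \sum_(T in SYT la | #|Des T| == i) 'X^(maj T).

Definition ratfun : fieldType := {fraction {poly rat}}.

Definition q : ratfun := tofrac 'X.

Definition qpoch (N : nat) : ratfun := \prod_(1 <= j < N.+1) (1 - q ^+ j).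

Definition qbinom (A B : nat) : ratfun :=
  if (B <= A)%N then qpoch A / (qpoch B * qpoch (A - B)%N) else 0.

(* Main.v *)
(* A standard tableau of shape (a, b) is a ballot word: reading the entries in
   order, each one records the row that holds it, and no prefix visits the bottom
   row more often than the top one.  A descent is a top letter followed by a
   bottom letter.  Let F(n, k, i) be the generating function of the major index
   over ballot words of length n with k bottom letters and i descents.
   Peeling off the last letter, and then the last letter of what remains, gives
     F(n+2, k+1, i+1) = F(n+1, k+1, i+1) + F(n+1, k, i+1) - F(n, k, i+1)
                        + q^(n+1) F(n, k, i)        for 2k <= n,
   and the product formula satisfies the same recurrence.  At n = 2k - 1 the
   factor 1 - q^(n-2k+1) of the formula vanishes, as does F. *)
Require Import Defs.
From mathcomp Require Import all_boot all_order all_algebra.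
From mathcomp Require Import zify ring.
Import GRing.Theory.
Set Implicit Arguments.
Unset Strict Implicit.
Local Open Scope ring_scope.

(** * Ballot words with their descents and major index *)

Fixpoint words (m : nat) : seq (seq bool) :=
  if m is m'.+1 then map (cons false) (words m') ++ map (cons true) (words m')
  else [:: [::]].

Lemma mem_words m (w : seq bool) : (w \in words m) = (size w == m).
Proof.
have mem_cons x y w' s : (x :: w' \in map (cons y) s) = (x == y) && (w' \in s).
  apply/mapP/andP => [[v v_s [-> ->]]|[/eqP-> w_s]]; first by rewrite v_s eqxx.
  by exists w'.
elim: m w => [|m IHm] [|x w] //=; rewrite mem_cat.
  by apply/negP => /orP[] /mapP[].
by rewrite eqSS -IHm !mem_cons; case: x; rewrite ?orbF.
Qed.

Lemma words_uniq m : uniq (words m).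
Proof.
elim: m => //= m IHm.
rewrite cat_uniq !map_inj_uniq ?IHm ?andbT /=; try by move=> ? ? [].
by apply/hasPn => _ /mapP[v _ ->]; apply/mapP => -[].
Qed.

(* Words are stored with their last letter at the head; [true] is the bottom row. *)
Fixpoint ballot (w : seq bool) : bool :=
  if w is _ :: w' then (count id w <= count negb w)%N && ballot w' else true.

(* The default [true] in [head] keeps an initial letter from being a descent. *)
Fixpoint wdes (w : seq bool) : nat :=
  if w is x :: w' then (wdes w' + (x && ~~ head true w'))%N else 0%N.

(** A descent completed by the letter [x] sits at [size w'], the number of letters read before
    [x]. *)
Fixpoint wmaj (w : seq bool) : nat :=
  if w is x :: w' then (wmaj w' + size w' * (x && ~~ head true w'))%N else 0%N.

Lemma ballot_count w : ballot w -> (count id w <= count negb w)%N.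
Proof. by case: w => //= x w /andP[]. Qed.

Lemma ballot_false w : ballot (false :: w) = ballot w.
Proof.
by rewrite /=; have [/ballot_count|] := boolP (ballot w); lia.
Qed.

Lemma count_id_negb w : (count id w + count negb w = size w)%N.
Proof. exact: count_predC. Qed.

(** * Generating functions of ballot words and their recurrence *)

Section WordSums.

Variables (R : comNzRingType) (z : R).

Lemma big_wordsS m (P : pred (seq bool)) (F : seq bool -> R) :
  \sum_(w <- words m.+1 | P w) F w =
    \sum_(w <- words m | P (false :: w)) F (false :: w)
    + \sum_(w <- words m | P (true :: w)) F (true :: w).
Proof. by rewrite big_cat !big_map. Qed.

Definition wsum (m k i : nat) : R :=
  \sum_(w <- words m | [&& ballot w, count id w == k & wdes w == i]) z ^+ wmaj w.

(** The default [false] in [head] excludes the empty word, which ends in no bottom letter. *)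
Definition wsum_bottom (m k i : nat) : R :=
  \sum_(w <- words m | [&& ballot w, count id w == k, wdes w == i & head false w])
    z ^+ wmaj w.

(** A final top letter never breaks the ballot condition and completes no descent, so removing it
    changes no statistic. *)
Lemma wsumS m k i : wsum m.+1 k i = wsum m k i + wsum_bottom m.+1 k i.
Proof.
rewrite /wsum /wsum_bottom !big_wordsS.
rewrite [X in _ = _ + (X + _)]big1 ?add0r => [|w]; last by rewrite !andbF.
congr (_ + _); last by apply: eq_bigl => w; rewrite andbT.
apply: eq_big => [w|w _]; last by rewrite /= muln0 addn0.
by rewrite ballot_false /= addn0.
Qed.

Lemma wsum_bottom0 m i : wsum_bottom m 0 i = 0.
Proof. by rewrite /wsum_bottom big1_seq // => -[|[] w] /=; rewrite ?andbF. Qed.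

Lemma wsum_small m k i : (m < 2 * k)%N -> wsum m k i = 0.
Proof.
move=> m_k; rewrite /wsum big1_seq // => /= w; rewrite mem_words.
case/andP=> /and3P[/ballot_count + /eqP + _] /eqP.
by have := count_id_negb w => ? ? ? ?; exfalso; lia.
Qed.

(** Split on the letter before the final bottom letter. After a bottom letter there is no new
    descent; after a top letter there is one, at position [m.+1]. The bound on [k] makes the ballot
    inequality of the whole word automatic. *)
Lemma wsum_bottomSS m k i : (2 * k <= m)%N ->
  wsum_bottom m.+2 k.+1 i = wsum_bottom m.+1 k i
    + (if i is i'.+1 then z ^+ m.+1 * wsum m k i' else 0).
Proof.
move=> k_m; rewrite /wsum_bottom !(big_wordsS m.+1).
rewrite big1 ?add0r => [|w]; last by rewrite !andbF.
rewrite big_wordsS [X in _ = X + _]big_wordsS.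
rewrite [X in _ = X + _ + _]big1 ?add0r => [|w]; last by rewrite !andbF.
rewrite addrC; congr (_ + _).
  rewrite big_seq_cond [RHS]big_seq_cond; apply: eq_big => [w|w _]; last first.
    by rewrite /= !muln0 !addn0.
  rewrite mem_words; case: eqP => //= w_m.
  rewrite !add0n !add1n addn0 eqSS; case: (_ =P k) => [w_k|]; last by rewrite !andbF.
  by have -> : ((count id w).+2 <= count negb w)%N by have := count_id_negb w; lia.
case: i => [|i].
  by apply: big1_seq => w /andP[/and4P[_ _ /eqP /=]]; lia.
rewrite /wsum big_distrr big_seq_cond [RHS]big_seq_cond; apply: eq_big => [w|w] /=.
  rewrite mem_words; case: eqP => //= w_m.
  rewrite !add0n !add1n addn0 addn1 !eqSS andbT.
  case: (_ =P k) => [w_k|]; last by rewrite !andbF.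
  have := ballot_false w => /= ->.
  have -> // : (count id w < (count negb w).+1)%N by have := count_id_negb w; lia.
rewrite mem_words => /andP[/eqP-> _].
by rewrite muln0 addn0 muln1 exprD mulrC.
Qed.

Lemma wsum_rec m k i : (2 * k <= m)%N ->
  wsum m.+2 k.+1 i = wsum m.+1 k.+1 i + (wsum m.+1 k i - wsum m k i)
    + (if i is i'.+1 then z ^+ m.+1 * wsum m k i' else 0).
Proof.
move=> k_m; rewrite wsumS wsum_bottomSS // [wsum m.+1 k i]wsumS.
by rewrite [_ + wsum_bottom _ _ _]addrC addrK addrA.
Qed.

Lemma wsum_0bottom m i : wsum m 0 i = (i == 0)%:R.
Proof.
elim: m => [|m IHm]; last by rewrite wsumS wsum_bottom0 addr0.
by rewrite /wsum big_mkcond big_seq1 /=; case: i.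
Qed.

(** The closed form below covers only positive descent numbers; this supplies the remaining case.
    The recurrence preserves it because its last term vanishes when [i] is 0. *)
Lemma wsum_0des m k : wsum m k 0 = (k == 0%N)%:R.
Proof.
have [n le_mn] := ubnP m; elim: n => // n IHn in m k le_mn *.
case: k => [|k]; first by rewrite wsum_0bottom.
have [k_m|m_k] := leqP (2 * k.+1) m; last by rewrite wsum_small.
case: m k_m le_mn => [|[|m]] k_m le_mn; [lia | lia |].
rewrite wsum_rec; last by lia.
by rewrite !IHn ?subrr ?addr0 //; lia.
Qed.

End WordSums.

(** * Gaussian binomials and the product formula *)

Section GaussBinomial.

Variables (K : fieldType) (z : K).
Hypothesis z_neq0 : z != 0.
Hypothesis subr1z_neq0 : forall m, 1 - z ^+ m.+1 != 0.

Definition q_pochhammer (m : nat) : K := \prod_(1 <= j < m.+1) (1 - z ^+ j).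

Definition gauss_binom (m i : nat) : K :=
  if (i <= m)%N then q_pochhammer m / (q_pochhammer i * q_pochhammer (m - i)%N) else 0.

Lemma q_pochhammerS m : q_pochhammer m.+1 = q_pochhammer m * (1 - z ^+ m.+1).
Proof. by rewrite /q_pochhammer big_nat_recr. Qed.

Lemma q_pochhammer_neq0 m : q_pochhammer m != 0.
Proof.
elim: m => [|m IHm]; first by rewrite /q_pochhammer big_geq ?oner_neq0.
by rewrite q_pochhammerS mulf_neq0 // subr1z_neq0.
Qed.

Lemma gauss_binom0 m : gauss_binom m 0 = 1.
Proof.
rewrite /gauss_binom /= subn0 {2}/q_pochhammer big_geq // mul1r.
by rewrite divff ?q_pochhammer_neq0.
Qed.

Lemma gauss_binom_small m i : (m < i)%N -> gauss_binom m i = 0.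
Proof. by rewrite /gauss_binom ltnNge => /negbTE->. Qed.

Lemma gauss_binomSS m i :
  gauss_binom m.+1 i.+1 = (1 - z ^+ m.+1) / (1 - z ^+ i.+1) * gauss_binom m i.
Proof.
rewrite /gauss_binom ltnS subSS; case: ifP => _; last by rewrite mulr0.
rewrite !q_pochhammerS; field.
by rewrite !q_pochhammer_neq0 subr1z_neq0.
Qed.

(** The quotient [z ^+ m / z ^+ i] avoids truncated subtraction: the factor vanishes at [i = m], and
    for [m < i] both binomials are zero. *)
Lemma gauss_binomS m i :
  gauss_binom m i.+1 = (1 - z ^+ m / z ^+ i) / (1 - z ^+ i.+1) * gauss_binom m i.
Proof.
have [lt_im | | ->] := ltngtP i m.
- rewrite /gauss_binom lt_im ltnW // -(subnK lt_im) addnS subSS.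
  rewrite -addSn !addnK q_pochhammerS [_ (_ + i)%N in X in _ = X]exprD mulfK.
    by rewrite q_pochhammerS; field; rewrite !q_pochhammer_neq0 !subr1z_neq0.
  by rewrite expf_neq0 // z_neq0.
- by move=> lt_mi; rewrite !gauss_binom_small ?mulr0 // ltnW.
by rewrite gauss_binom_small // divff ?expf_neq0 ?z_neq0 // subrr !mul0r.
Qed.

(** For words of length n with K = [k.+1] bottom letters, [d] is n - 2K + 1. Allowing [d = 0]
    includes the boundary case n = 2K - 1, which the recurrence reaches. The induction is on the
    length. *)
Lemma wsum_closed k d i :
  wsum z (2 * k + d).+1 k.+1 i.+1 =
    z ^+ (k + i * i + i).+1 * (1 - z ^+ d) / (1 - z ^+ i.+1)
      * gauss_binom k i * gauss_binom (k + d) i.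
Proof.
have [n lt_n] := ubnP (2 * k + d); elim: n => // n IHn in k d i lt_n *.
case: d lt_n => [|d] lt_n.
  by rewrite wsum_small ?subrr ?mulr0 ?mul0r //; lia.
have -> : ((2 * k + d.+1).+1 = (2 * k + d).+2)%N by lia.
rewrite wsum_rec; last by lia.
rewrite IHn; last by lia.
(* For [k = 0] the recurrence reaches words without bottom letters, outside the closed form. *)
case: k lt_n => [|k] lt_n.
  rewrite !wsum_0bottom !add0n /= subrr addr0.
  case: i => [|i]; last first.
    by rewrite [gauss_binom 0 _]gauss_binom_small // !(mulr0, mul0r) addr0.
  rewrite !gauss_binom0 !mulr1 /= [z ^+ d.+1]exprS; field.
  exact: (subr1z_neq0 0).
(* With one bottom letter fewer, the offset is [d.+2] at length one less and [d.+1] at length two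
   less. *)
have -> : ((2 * k.+1 + d).+1 = (2 * k + d.+2).+1)%N by lia.
have -> : ((2 * k.+1 + d) = (2 * k + d.+1).+1)%N by lia.
rewrite !IHn; [|lia|lia].
have [-> ->] : (k + d.+2 = (k.+1 + d).+1)%N /\ (k + d.+1 = (k.+1 + d))%N by lia.
have -> : (k.+1 + d.+1 = (k.+1 + d).+1)%N by lia.
case: i => [|i].
  rewrite wsum_0des !gauss_binom0 mulr0 addr0 !mulr1 !addn0 !exprS; field.
  exact: (subr1z_neq0 0).
rewrite IHn; last by lia.
have -> : (k + d.+1 = k.+1 + d)%N by lia.
(* Every binomial becomes a multiple of [gauss_binom k i] or [gauss_binom (k.+1 + d) i]; what
   remains is a rational identity in powers of [z]. *)
rewrite (gauss_binomSS k) (gauss_binomSS (k.+1 + d)).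
rewrite (gauss_binomS k) (gauss_binomS (k.+1 + d)).
rewrite !(mulnS, mulSn, addSn, addnS, exprS, exprD) ?muln0 ?mul0n ?addn0.
have := subr1z_neq0 i; have := subr1z_neq0 i.+1; rewrite !exprS => Hi2 Hi1.
field.
by rewrite Hi1 Hi2 !expf_neq0 ?z_neq0.
Qed.

End GaussBinomial.

Lemma q_neq0 : q != 0.
Proof. by rewrite tofrac_eq0 polyX_eq0. Qed.

Lemma subr1q_neq0 m : 1 - q ^+ m.+1 != 0.
Proof.
rewrite -opprB oppr_eq0 /q -tofracXn -tofrac1 -tofracB tofrac_eq0.
by rewrite -size_poly_eq0 size_XnsubC.
Qed.

(** * Words read off from a row function *)

Local Open Scope nat_scope.

Definition history (r : nat -> bool) (m : nat) : seq bool := rev (mkseq r m).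

Lemma historyS r m : history r m.+1 = r m :: history r m.
Proof. by rewrite /history mkseqS rev_rcons. Qed.

Lemma size_history r m : size (history r m) = m.
Proof. by rewrite size_rev size_mkseq. Qed.

Definition letter_count (x : bool) (r : nat -> bool) (m : nat) : nat :=
  \sum_(j < m) (r j == x).

Lemma letter_countS x r m : letter_count x r m.+1 = letter_count x r m + (r m == x).
Proof. by rewrite /letter_count big_ord_recr. Qed.

Lemma leq_letter_count x r m p : m <= p -> letter_count x r m <= letter_count x r p.
Proof.
elim: p => [|p IHp]; first by case: m.
rewrite leq_eqVlt => /orP[/eqP->//|/IHp le_mp].
by rewrite letter_countS; lia.
Qed.

(** Discrete intermediate values: the count starts at 0 and grows by at most one per letter, so it
    steps from [c] to [c.+1] at some [j]. *)
Lemma letter_count_ex x r m c :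
  c < letter_count x r m -> exists j, [/\ j < m, r j = x & letter_count x r j = c].
Proof.
elim: m => [|m IHm]; first by rewrite /letter_count big_ord0.
rewrite letter_countS.
have [/IHm[j [lt_jm rj cj]] _|le_mc] := ltnP c (letter_count x r m).
  by exists j; rewrite ltnW.
case: eqP => [rm lt_c|_]; last by lia.
by exists m; split; lia.
Qed.

Lemma count_history_true r m : count id (history r m) = letter_count true r m.
Proof.
elim: m => [|m IHm]; first by rewrite /letter_count big_ord0.
by rewrite historyS letter_countS /= IHm eqb_id addnC.
Qed.

Lemma count_history_false r m : count negb (history r m) = letter_count false r m.
Proof.
elim: m => [|m IHm]; first by rewrite /letter_count big_ord0.
by rewrite historyS letter_countS /= IHm eqbF_neg addnC.
Qed.

Lemma ballot_historyP r m :
  reflect (forall p, p <= m -> letter_count true r p <= letter_count false r p)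
    (ballot (history r m)).
Proof.
elim: m => [|m IHm].
  by left; case=> // _; rewrite /letter_count !big_ord0.
have ballotE : ballot (history r m.+1)
    = (letter_count true r m.+1 <= letter_count false r m.+1) && ballot (history r m).
  by rewrite -count_history_true -count_history_false historyS.
rewrite ballotE; apply: (iffP andP) => [[le_m /IHm le_p] p|le_p].
  by rewrite leq_eqVlt => /orP[/eqP->//|]; apply: le_p.
by split; [exact: le_p | apply/IHm => p /leqW; apply: le_p].
Qed.

Definition descent_at (r : nat -> bool) (j : nat) : bool := [&& 0 < j, ~~ r j.-1 & r j].

Lemma descent_atE r j : (r j && ~~ head true (history r j)) = descent_at r j.
Proof. by case: j => [|j]; rewrite /descent_at ?andbF // historyS /= andbC. Qed.

Lemma wdes_history r m : wdes (history r m) = \sum_(j < m) descent_at r j.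
Proof.
elim: m => [|m IHm]; first by rewrite big_ord0.
by rewrite big_ord_recr historyS -IHm -descent_atE.
Qed.

Lemma wmaj_history r m : wmaj (history r m) = \sum_(j < m) j * descent_at r j.
Proof.
elim: m => [|m IHm]; first by rewrite big_ord0.
by rewrite big_ord_recr historyS -IHm /= descent_atE size_history.
Qed.

(** * The bijection between two-row standard tableaux and ballot words *)

Section TwoRows.

Variables a b : nat.
Notation la := [:: a; b].

Definition top_box (c : 'I_a) : box la :=
  existT (fun r : 'I_2 => 'I_(nth 0 la r)) ord0 c.
Definition bottom_box (c : 'I_b) : box la :=
  existT (fun r : 'I_2 => 'I_(nth 0 la r)) (lift ord0 ord0) c.

Lemma boxP (P : box la -> Prop) :
  (forall c, P (top_box c)) -> (forall c, P (bottom_box c)) -> forall x, P x.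
Proof.
move=> P0 P1 [r c].
have [er|er] : r = ord0 \/ r = lift ord0 ord0.
- by case: r {c} => [[|[|r]] lt_r] //; [left | right]; apply: val_inj.
- by subst r; apply: P0.
- by subst r; apply: P1.
Qed.

Lemma big_box (F : box la -> nat) :
  \sum_x F x = \sum_(c < a) F (top_box c) + \sum_(c < b) F (bottom_box c).
Proof.
pose G (r : 'I_2) (c : 'I_(nth 0 la r)) :=
  F (existT (fun r : 'I_2 => 'I_(nth 0 la r)) r c).
transitivity (\sum_r \sum_c G r c); last by rewrite !big_ord_recl big_ord0 addn0.
by rewrite sig_big_dep; apply: eq_bigr => -[r c].
Qed.

Lemma card_box : #|box la| = sumn la.
Proof. by rewrite -sum1_card big_box !sum1_card !card_ord /= addn0. Qed.

Lemma box_inj (x y : box la) :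
  box_row x = box_row y -> box_col x = box_col y -> x = y.
Proof.
by elim/boxP: x => c; elim/boxP: y => d //= _; rewrite /box_col /= => /val_inj->.
Qed.

Notation n := (sumn la).

(** Letters are indexed from 0 and entries from 1, so letter [j] records the row of entry [j.+1]. *)
Definition in_bottom (T : filling la) (j : nat) : bool :=
  [exists x, (T x == j.+1 :> nat) && (box_row x == 1)].

Section Standard.

Variable T : filling la.
Hypothesis T_SYT : is_SYT T.

Lemma SYT_perm : perm_eq [seq val (T x) | x : box la] (iota 1 n).
Proof. by case/and3P: T_SYT. Qed.

Lemma SYT_row x y : box_row x = box_row y -> box_col x < box_col y -> T x < T y.
Proof.
case/and3P: T_SYT => _ /forallP/(_ x)/forallP/(_ y)/implyP lt_T _ rE lt_c.
by apply: lt_T; rewrite rE eqxx.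
Qed.

Lemma SYT_col x y : box_col x = box_col y -> box_row x < box_row y -> T x < T y.
Proof.
case/and3P: T_SYT => _ _ /forallP/(_ x)/forallP/(_ y)/implyP lt_T rE lt_c.
by apply: lt_T; rewrite rE eqxx.
Qed.

Lemma SYT_val_inj x y : T x = T y :> nat -> x = y.
Proof.
have : uniq [seq val (T x) | x : box la] by rewrite (perm_uniq SYT_perm) iota_uniq.
by move=> /injectiveP T_inj /T_inj.
Qed.

Lemma SYT_surj j : 0 < j <= n -> exists x, T x = j :> nat.
Proof.
move=> j_n; have : j \in iota 1 n by rewrite mem_iota add1n.
by rewrite -(perm_mem SYT_perm) => /codomP[x ->]; exists x.
Qed.

Lemma SYT_gt0 x : 0 < T x.
Proof.
have : val (T x) \in iota 1 n.
  by rewrite -(perm_mem SYT_perm) (image_f (fun x => val (T x))).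
by rewrite mem_iota => /andP[].
Qed.

Lemma in_bottomE x : in_bottom T (T x).-1 = (box_row x == 1).
Proof.
apply/existsP/eqP => [[y /andP[]]|x1].
  by rewrite prednK ?SYT_gt0 // => /eqP/SYT_val_inj-> /eqP.
by exists x; rewrite prednK ?SYT_gt0 // eqxx x1 eqxx.
Qed.

Lemma row_in_bottom x : box_row x = in_bottom T (T x).-1.
Proof. by rewrite in_bottomE; elim/boxP: x. Qed.

Lemma big_SYT (F : nat -> nat) : \sum_(j < n) F j = \sum_x F (T x).-1.
Proof.
transitivity (\sum_(j <- iota 1 n) F j.-1).
  rewrite -(big_mkord xpredT F) /index_iota subn0 (iotaDl 1 0) big_map.
  exact: eq_bigr.
by rewrite -(perm_big _ SYT_perm) big_map big_enum.
Qed.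

Lemma letter_count_in_bottom v m : m <= n ->
  letter_count v (in_bottom T) m = \sum_x (((T x).-1 < m) && (box_row x == v)).
Proof.
move=> le_mn; rewrite /letter_count.
rewrite (big_ord_widen_cond _ xpredT (fun j => nat_of_bool (in_bottom T j == v)) le_mn).
rewrite big_mkcond.
rewrite (big_SYT (fun j => if j < m then nat_of_bool (in_bottom T j == v) else 0)).
apply: eq_bigr => x _; rewrite in_bottomE; case: (_ < m) => //=.
by congr (nat_of_bool _); elim/boxP: x => c; case: v.
Qed.

(** Rows increase, so the smaller entries in the row of [x] are exactly those to its left. Hence the
    word determines columns as well as rows. *)
Lemma letter_count_col x :
  letter_count (box_row x == 1) (in_bottom T) (T x).-1 = box_col x.
Proof.
rewrite letter_count_in_bottom; last by have := ltn_ord (T x); lia.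
have ltE y : box_row y = box_row x -> ((T y).-1 < (T x).-1) = (box_col y < box_col x).
  move=> yx; have := SYT_gt0 x; have := SYT_gt0 y.
  case: (ltngtP (box_col y) (box_col x)) => [lt_c|lt_c|eq_c].
  - by have := SYT_row yx lt_c; lia.
  - by have := SYT_row (esym yx) lt_c; lia.
  - by rewrite (box_inj yx eq_c) ltnn.
have sum_lt p c : c <= p -> \sum_(d < p) (d < c) = c.
  move=> le_cp; rewrite -[RHS]card_ord -sum1_card (big_ord_widen _ (fun=> 1) le_cp).
  by rewrite [RHS]big_mkcond; apply: eq_bigr => d _; case: ifP.
elim/boxP: x ltE => c ltE; rewrite big_box /=.
  rewrite [X in _ + X]big1 ?addn0 => [|d _]; last by rewrite andbF.
  under eq_bigr => d _ do rewrite andbT ltE //.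
  by rewrite sum_lt // ltnW // ltn_ord.
rewrite big1 ?add0n => [|d _]; last by rewrite andbF.
under eq_bigr => d _ do rewrite andbT ltE //.
by rewrite sum_lt // ltnW // ltn_ord.
Qed.

Lemma letter_count_true : letter_count true (in_bottom T) n = b.
Proof.
rewrite letter_count_in_bottom // big_box big1 ?add0n => [|d _]; last by rewrite andbF.
rewrite -[RHS]card_ord -sum1_card; apply: eq_bigr => d _; rewrite andbT.
have := ltn_ord (T (bottom_box d)); have := SYT_gt0 (bottom_box d).
by case: ltnP => //; lia.
Qed.

(** Above each bottom box with entry at most [m] lies a top box with a smaller entry, so the first
    [b] top boxes already provide enough top letters. *)
Lemma ballot_in_bottom : b <= a -> ballot (history (in_bottom T) n).
Proof.
move=> le_ba; apply/ballot_historyP => m le_m.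
rewrite !letter_count_in_bottom // !big_box /=.
rewrite [X in X + _ <= _]big1 ?add0n => [|d _]; last by rewrite andbF.
rewrite [X in _ <= _ + X]big1 => [|d _]; last by rewrite andbF.
pose F (c : 'I_a) : nat := (((T (top_box c)).-1 < m) && (box_row (top_box c) == 0)).
apply: (@leq_trans (\sum_(c < a | c < b) F c)).
  rewrite (big_ord_narrow le_ba); apply: leq_sum => c _; rewrite /F !andbT.
  have : T (top_box (widen_ord le_ba c)) < T (bottom_box c) by apply: SYT_col.
  by case: (ltnP (T (bottom_box c)).-1 m) => //; case: ltnP => //; lia.
by rewrite addn0 [X in X <= _]big_mkcond; apply: leq_sum => c _; case: ifP.
Qed.

Lemma mem_Des (j : 'I_n) : (j \in Des T) = descent_at (in_bottom T) j.
Proof.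
rewrite inE /descent_at; case: (posnP j) => //= j_gt0.
have [x Tx] : exists x, T x = j :> nat by apply: SYT_surj; rewrite j_gt0 ltnW.
have [y Ty] : exists y, T y = j.+1 :> nat by apply: SYT_surj; rewrite /= ltn_ord.
have -> : in_bottom T j = (box_row y == 1) by rewrite -in_bottomE Ty.
have -> : in_bottom T j.-1 = (box_row x == 1) by rewrite -in_bottomE Tx.
transitivity (box_row x < box_row y); last first.
  by elim/boxP: x {Tx}; elim/boxP: y {Ty}.
apply/existsP/idP => [[x' /existsP[y' /and3P[/eqP Tx' /eqP Ty']]]|lt_xy].
  rewrite (@SYT_val_inj x' x) ?Tx ?Tx' //.
  by rewrite (@SYT_val_inj y' y) ?Ty ?Ty'.
by exists x; apply/existsP; exists y; rewrite Tx Ty !eqxx.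
Qed.

Lemma card_DesE : #|Des T| = wdes (history (in_bottom T) n).
Proof.
rewrite wdes_history -sum1_card big_mkcond; apply: eq_bigr => j _.
by rewrite mem_Des; case: ifP.
Qed.

Lemma majE : maj T = wmaj (history (in_bottom T) n).
Proof.
rewrite wmaj_history /maj big_mkcond; apply: eq_bigr => j _.
by rewrite mem_Des; case: ifP; rewrite ?muln1 ?muln0.
Qed.

End Standard.

(** The letter of an entry gives its row, and the number of equal letters before it gives its
    column. *)
Lemma history_in_bottom_inj T U : is_SYT T -> is_SYT U ->
  history (in_bottom T) n = history (in_bottom U) n -> T = U.
Proof.
move=> T_SYT U_SYT /(can_inj revK) eqTU.
have {}eqTU j : j < n -> in_bottom T j = in_bottom U j.
  by move=> lt_j; have := congr1 (nth false ^~ j) eqTU; rewrite !nth_mkseq.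
apply/ffunP => x; apply: val_inj => /=.
have lt_x : (T x).-1 < n by have := ltn_ord (T x); have := SYT_gt0 T_SYT x; lia.
have [y Uy] : exists y, U y = T x :> nat.
  by apply: SYT_surj => //; rewrite SYT_gt0 // -ltnS ltn_ord.
suff xy : x = y by rewrite -Uy -xy.
have row_xy : box_row x = box_row y.
  by rewrite (row_in_bottom T_SYT) (row_in_bottom U_SYT) Uy eqTU.
apply: box_inj => //.
rewrite -(letter_count_col T_SYT) -(letter_count_col U_SYT) row_xy Uy.
rewrite /letter_count; apply: eq_bigr => j _; rewrite eqTU //.
by apply: ltn_trans lt_x; apply: ltn_ord.
Qed.

(** The inverse map fills each row, from left to right, with the positions of its letters. The
    ballot condition makes the columns increase. *)
Lemma history_in_bottom_surj r : ballot (history r n) -> letter_count true r n = b ->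
  exists2 T, is_SYT T & history (in_bottom T) n = history r n.
Proof.
move=> /ballot_historyP r_ballot r_b.
have r_a : letter_count false r n = a.
  have := count_id_negb (history r n).
  by rewrite count_history_true count_history_false size_history r_b /=; lia.
have pos_ex (x : box la) : exists j : 'I_n,
    (r j == (box_row x == 1)) && (letter_count (r j) r j == box_col x).
  have : box_col x < letter_count (box_row x == 1) r n.
    by elim/boxP: x => c; rewrite /= ?r_a ?r_b; apply: ltn_ord.
  case/letter_count_ex => j [lt_j rj cj].
  by exists (Ordinal lt_j); rewrite /= rj cj !eqxx.
pose pos x := xchoose (pos_ex x).
have pos_r x : r (pos x) = (box_row x == 1).
  by have /andP[/eqP] := xchooseP (pos_ex x).
have pos_c x : letter_count (box_row x == 1) r (pos x) = box_col x.
  by have /andP[_ /eqP] := xchooseP (pos_ex x); rewrite -/(pos x) pos_r.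
have pos_lt x y : r (pos x) = r (pos y) -> box_col x < box_col y -> pos x < pos y.
  by move=> rE; rewrite !ltnNge -!pos_c -!pos_r rE; apply/contra/leq_letter_count.
have pos_inj : injective pos.
  move=> x y xy; apply: box_inj.
    have := pos_r x; rewrite xy pos_r.
    by elim/boxP: x {xy} => ?; elim/boxP: y => ?.
  by rewrite -!pos_c -!pos_r xy.
(* [lift ord0] turns the positions 0, ..., n-1 into the entries 1, ..., n. *)
pose T : filling la := [ffun x => lift ord0 (pos x)].
have TE x : T x = (pos x).+1 :> nat by rewrite ffunE lift0.
have T_inj : injective (fun x => val (T x)).
  by move=> x y /= xy; apply/pos_inj/val_inj/succn_inj; rewrite -!TE.
have T_SYT : is_SYT T.
  apply/and3P; split.
  - apply: uniq_perm; rewrite ?iota_uniq //.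
      exact/injectiveP.
    (* Distinct entries, one per box, lying in a list of the same size must exhaust it. *)
    apply: (uniq_min_size _ _ _).2.
    + exact/injectiveP.
    + move=> _ /codomP[x ->].
      by rewrite mem_iota add1n ltn_ord andbT -[val _]/(T x : nat) TE.
    + by rewrite size_iota size_map -cardE card_box.
  - apply/forallP => x; apply/forallP => y; apply/implyP => /andP[/eqP xy lt_xy].
    by rewrite !TE ltnS; apply: pos_lt lt_xy; rewrite !pos_r xy.
  - apply/forallP => x; apply/forallP => y; apply/implyP => /andP[/eqP xy lt_xy].
    (* If the lower box [y] came first, the prefix ending at its letter would hold [(box_col y).+1]
       bottom letters but at most [box_col y] top letters. *)
    rewrite !TE ltnS ltnNge; apply/negP => le_yx.
    have [x0 y1] : (box_row x == 1) = false /\ (box_row y == 1) = true.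
      by elim/boxP: x {xy le_yx} lt_xy => ?; elim/boxP: y => ?.
    have lt_yx : pos y < pos x.
      rewrite ltn_neqAle le_yx andbT; apply: contraFneq x0 => /val_inj eq_yx.
      by rewrite -pos_r -eq_yx pos_r y1.
    have := pos_c x; have := pos_c y; rewrite x0 y1 -xy => cy cx.
    move: (r_ballot (pos y).+1 (ltn_ord _)) (leq_letter_count false r lt_yx).
    by rewrite letter_countS pos_r y1 cx cy; lia.
exists T => //; congr rev; apply/eq_in_map => j; rewrite mem_iota add0n => /= lt_j.
have [x Tx] := SYT_surj T_SYT (j := j.+1) (introT andP (conj isT lt_j)).
by move: (Tx); rewrite TE => -[<-]; rewrite pos_r -(in_bottomE T_SYT) TE.
Qed.

Lemma history_nth w : w = history (nth false (rev w)) (size w).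
Proof. by rewrite /history -(size_rev w) mkseq_nth revK. Qed.

Lemma perm_SYT_ballot_words : b <= a ->
  perm_eq [seq history (in_bottom T) n | T in SYT la]
    [seq w <- words n | ballot w && (count id w == b)].
Proof.
move=> le_ba; apply: uniq_perm.
- rewrite map_inj_in_uniq ?enum_uniq // => T U.
  by rewrite !mem_enum !inE; apply: history_in_bottom_inj.
- by rewrite filter_uniq ?words_uniq.
move=> w; rewrite mem_filter mem_words.
apply/imageP/andP => [[T]|[/andP[w_ballot /eqP w_b] /eqP w_n]].
  rewrite inE => T_SYT ->.
  rewrite ballot_in_bottom // count_history_true letter_count_true //.
  by rewrite size_history !eqxx.
move: w_ballot w_b; rewrite (history_nth w) w_n count_history_true => w_ballot w_b.
have [T T_SYT <-] := history_in_bottom_surj w_ballot w_b.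
by exists T; rewrite ?inE.
Qed.

End TwoRows.

(** * From tableaux to words, and the formula for rational functions *)

Local Open Scope ring_scope.

Lemma maj_genfunE a b i : (b <= a)%N -> maj_genfun [:: a; b] i = wsum 'X (a + b) b i.
Proof.
move=> le_ba; rewrite /maj_genfun /wsum.
have -> : (a + b = sumn [:: a; b])%N by rewrite /= addn0.
set n := sumn _.
pose words_of_SYT := [seq history (in_bottom T) n | T in SYT [:: a; b]].
transitivity (\sum_(w <- words_of_SYT | wdes w == i) 'X^(wmaj w) : {poly rat}).
  rewrite big_map big_enum_cond; apply: eq_big => [T|T /andP[]].
    by rewrite inE; case: (boolP (is_SYT T)) => //= T_SYT; rewrite card_DesE.
  by rewrite inE => T_SYT _; rewrite majE.
rewrite (perm_big _ (perm_SYT_ballot_words le_ba)) big_filter_cond.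
by apply: eq_bigl => w; rewrite andbA.
Qed.

Lemma rmorph_wsum (R S : comNzRingType) (f : {rmorphism R -> S}) (z : R) m k i :
  f (wsum z m k i) = wsum (f z) m k i.
Proof. by rewrite rmorph_sum; apply: eq_bigr => w _; rewrite rmorphXn. Qed.

Unset Implicit Arguments.

Theorem theorem1 (n k i : nat) (i_ge1 : (1 <= i)%N) (k_ge1 : (1 <= k)%N)
    (n_ge2k : (2 * k <= n)%N) :
  tofrac (maj_genfun [:: (n - k)%N; k] i) =
    q ^+ (k + i ^ 2 - i) * (1 - q ^+ (n - 2 * k + 1)) / (1 - q ^+ i)
      * qbinom (k - 1) (i - 1) * qbinom (n - k) (i - 1).
Proof.
rewrite maj_genfunE; last by lia.
rewrite rmorph_wsum -/q.
case: k k_ge1 n_ge2k => // k _ n_ge2k; case: i i_ge1 => // i _.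
(* The offset [d] of [wsum_closed] is [n - 2 * k.+1 + 1]. *)
have -> : (n - k.+1 + k.+1 = (2 * k + (n - 2 * k.+1 + 1)).+1)%N by lia.
rewrite wsum_closed; [|exact: q_neq0|exact: subr1q_neq0].
have -> : (n - k.+1 = k + (n - 2 * k.+1 + 1))%N by lia.
have -> : (k.+1 + i.+1 ^ 2 - i.+1 = (k + i * i + i).+1)%N by nia.
(* At [z = q], [gauss_binom] is [qbinom] by conversion. *)
by rewrite !subSS !subn0.
Qed.
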